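(* Let $G$ be a $(v,k,\lambda)_0$ relative skew Hadamard difference set group with subgroup $H$ and difference set $D$, and let $h=|H|$. Then: (a) (i) every index $2$ subgroup of $G$ contains $H$, and $D$ meets each such subgroup in exactly $\lambda$ points; (ii) if $N\triangleleft G$ is a normal subgroup of odd prime index $p$, then $H\le N$; in this situation each coset of $N$ other than $N$ itself meets $D$ in exactly $\frac{1}{2p}h^2$ elements, while $|N\cap D|=\frac{1}{2p}h(h-p)$. (b) If $G$ is in addition a $2$-group, then $H\le\Phi(G)$, and $D$ meets each maximal subgroup of $G$ in exactly $\lambda$ points.
   Context: A $(v,k,\lambda)$ difference set in a finite group $G$ with $|G|=v$ is a non-empty subset $D\subset G$ with $|D|=k$ such that every $1\neq g\in G$ occurs exactly $\lambda$ times in the multiset $\{xy^{-1}:x,y\in D\}$. For $X\subseteq G$ write $X^{-1}=\{x^{-1}:x\in X\}$. A finite group $G$ is a $(v,k,\lambda)_0$ relative skew Hadamard difference set group with difference set $D$ and subgroup $H$ if $D\subset G$ is a $(v,k,\lambda)$ difference set, $1\ne H\le G$, $D\cap D^{-1}=\emptyset$ and $G\setminus(D\cup D^{-1})=H$. $\Phi(G)$ denotes the Frattini subgroup of $G$, the intersection of all maximal subgroups of $G$. *)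

(* Defs.v *)
From mathcomp Require Import all_boot all_order all_algebra.
From mathcomp Require Import all_fingroup all_solvable.

Set Implicit Arguments.
Unset Strict Implicit.
Unset Printing Implicit Defensive.

Import GroupScope.

(* The cardinal below is the multiplicity of g in the multiset
   {x y^-1 : x, y in D}. *)
Definition difference_set (gT : finGroupType) (v k lambda : nat)
    (G : {group gT}) (D : {set gT}) : Prop :=
  [/\ #|G| = v, D \subset G, D != set0, #|D| = k &
      forall g : gT, g \in G -> g != 1 ->
        #|[set xy in setX D D | xy.1 * xy.2^-1 == g]| = lambda].

(* D^-1 is the library's pointwise inverse of a set in a group. *)
Definition relative_skew_hadamard (gT : finGroupType) (v k lambda : nat)
    (G : {group gT}) (D : {set gT}) (H : {group gT}) : Prop :=
  [/\ difference_set v k lambda G D,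
      H :!=: 1,
      H \subset G,
      D :&: D^-1 = set0 &
      G :\: (D :|: D^-1) = H].

(* Main.v *)
Require Import Defs.
From mathcomp Require Import all_boot all_order all_algebra.
From mathcomp Require Import all_fingroup all_solvable.
From mathcomp Require Import zify ring.

(** Write h for the order of H and n for k - lambda.  Since G is the disjoint
    union of D, D^-1 and H, v = 2 k + h; combining this with the counting
    identity k (k - 1) = lambda (v - 1) shows that v - 1 divides h^2 - 1.  As h
    also divides v, a size argument forces v = h^2 ([eq_square_of_skew_eqn]), so
    h = 2 u, k = 2 u^2 - u and lambda = u^2 - u ([menon_parameters]).

    For a normal subgroup N with quotient Q = G / N, let d z = #|D :&: z| for
    each coset z of N.  In the integral group ring of Q, d is the image of D,
    hence
    - d * d^-1 is lambda #|N| off the identity, with n more at the identity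
      ([sum_coset_meet_diff]);
    - d z + d z^-1 + #|H :&: z| = #|N| ([coset_meet_skew]).

    If N has prime index p, then either H lies in N, or H is equidistributed
    over the cosets of N.  The second possibility must be excluded.  For p = 2
    it would make d constant, which contradicts n > 0.  For p odd, the
    antisymmetric function E = 2 d - c, with c chosen so that E 1 = 0, has a
    convolution square constant off 1, and sum 0.  In character terms each
    nontrivial value chi(E) would be h times a square root of -1, but no p-th
    cyclotomic field with p odd contains one.  [no_flat_square] proves this
    impossibility by elementary means, a 2-adic descent ended by a congruence
    modulo 4.

    Once H lies in N, the skew relation at the identity coset gives d 1.  When
    p is odd, the first two moments of d are then known, and they show that d
    has variance 0 on the other cosets, so that all these values are equal.  In
    a 2-group every maximal subgroup has index 2, whence the last part. *)

Set Implicit Arguments.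
Unset Strict Implicit.
Unset Printing Implicit Defensive.

Import Order.TTheory GRing.Theory Num.Theory GroupScope.

(** * Functions on an odd abelian group with a flat convolution square *)

(** [B] takes one point from each orbit.  It is chosen before [F], so that the
    constant function 1 yields its cardinality. *)
Lemma involution_halves (T : finType) (s : T -> T) (A : {set T}) :
    involutive s -> {in A, forall y, (s y \in A) && (s y != y)} ->
  exists B : {set T}, B \subset A /\
    forall F : T -> int, (forall y, F (s y) = F y) ->
      (\sum_(y in A) F y = 2 * \sum_(y in B) F y)%R.
Proof.
move=> sK sA; exists [set y in A | enum_rank y < enum_rank (s y)].
split=> [|F Fs]; first by apply/subsetP=> y /setIdP[].
rewrite (bigID (fun y => enum_rank y < enum_rank (s y))) /= mulr2n mulrDl mul1r.
congr (_ + _)%R; first by apply: eq_bigl => y; rewrite inE.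
rewrite (reindex_inj (inv_inj sK)); apply: eq_big => [y|y _]; last exact: Fs.
rewrite inE sK -leqNgt leq_eqVlt.
apply/andP/andP=> [] [Ay le].
  have /andP[Asy ne] := sA _ Ay; rewrite sK in Asy ne; split=> //.
  case/orP: le => // /eqP/val_inj/enum_rank_inj e.
  by rewrite -e eqxx in ne.
by have /andP[-> _] := sA _ Ay; rewrite le orbT.
Qed.

Lemma sum_odd_int (T : finType) (B : {set T}) (F : T -> int) :
    {in B, forall y, (F y %% 2)%Z = 1%R} ->
  (((\sum_(y in B) F y) - #|B|%:Z)%R %% 2)%Z = 0%R.
Proof.
move=> Fodd.
have -> : (#|B|%:Z = \sum_(y in B) 1)%R by rewrite sumr_const natz.
rewrite -sumrB; apply: (big_ind (fun x : int => (x %% 2)%Z = 0%R)) => //.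
  by lia.
by move=> y /Fodd; lia.
Qed.

(** In the sum of E y * E (y^-1 x^2), the involution y |-> y^-1 x^2 has the
    single fixed point x, since Q has odd order; hence C = E x ^+ 2 modulo 2 for
    every x != 1.  All values of E off 1 thus have the parity of C.  If C is
    even, then E, h and C can be divided by 2, 2 and 4, and the descent goes on.
    If C is odd, the terms at y = 1 and y = x^2 vanish and the other #|Q| - 3
    terms are odd and paired off, so C = 1 + (#|Q| - 3) modulo 4 and
    C * #|Q| = -1 modulo 4, which is not an odd square. *)
Lemma no_flat_square (gT : finGroupType) (Q : {group gT}) :
    abelian Q -> odd #|Q| -> Q :!=: 1 ->
  forall (h : nat) (C : int) (E : gT -> int), 0 < h -> E 1 = 0%R ->
    (C * #|Q|%:Z = h%:Z ^+ 2)%R ->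
    {in Q, forall z, z != 1 -> (\sum_(y in Q) E y * E (y^-1 * z)%g = C)%R} ->
  False.
Proof.
move=> abQ oddQ ntQ; have [x Qx ntx] := trivgPn _ ntQ.
have sq1 z : z \in Q -> z ^+ 2 = 1 -> z = 1.
  move=> Qz z2; apply/eqP; rewrite -order_eq1.
  have := order_dvdG Qz => /dvdnP[m e]; move: oddQ; rewrite e oddM => /andP[_].
  have : #[z] %| 2 by rewrite order_dvdn z2.
  by case/primeP: (isT : prime 2) => _ dv /dv /orP[|/eqP->].
elim/ltn_ind=> h IH C E h0 E1 hC EC.
(* The points 1 and z^2 are left out of the pairing: E 1 = 0 makes their
   contribution vanish, but they would spoil the parity count of the rest. *)
have half z : z \in Q -> z != 1 -> exists B : {set gT},
    [/\ B \subset Q :\: [set 1; z ^+ 2], (2 * #|B| + 3 = #|Q|)%N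
      & C = (E z ^+ 2 + 2 * \sum_(y in B) E y * E (y^-1 * z ^+ 2)%g)%R].
  move=> Qz ntz; set s := fun y => if y \in Q then y^-1 * z ^+ 2 else y.
  have Q2 : z ^+ 2 \in Q by rewrite groupX.
  have nt2 : z ^+ 2 != 1 by apply: contra ntz => /eqP/sq1 ->.
  have sQ y : y \in Q -> y^-1 * z ^+ 2 \in Q.
    by move=> Qy; rewrite groupM ?groupV.
  have com y : y \in Q -> commute y (z ^+ 2).
    by move=> Qy; apply: (centsP abQ).
  have sK : involutive s.
    move=> y; rewrite /s; case Qy: (y \in Q); last by rewrite Qy.
    by rewrite sQ // invMg invgK -mulgA com // mulKg.
  have z2z : z ^+ 2 != z by rewrite expgS -{3}[z]mulg1 (inj_eq (mulgI z)).
  pose A := Q :\: [set 1; z; z ^+ 2].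
  have sA : {in A, forall y, (s y \in A) && (s y != y)}.
    move=> y; rewrite !inE !negb_or -!andbA => /and4P[n1 nz n2 Qy].
    have sy w : w \in Q -> s y = w -> y = w^-1 * z ^+ 2.
      by move=> Qw e; rewrite -[LHS]sK e /s Qw.
    apply/and5P; split.
    - by apply: contra n2 => /eqP/(sy _ (group1 Q)) ->; rewrite invg1 mul1g.
    - by apply: contra nz => /eqP/(sy _ Qz) ->; rewrite expgS mulKg.
    - by apply: contra n1 => /eqP/(sy _ Q2) ->; rewrite mulVg.
    - by rewrite /s Qy sQ.
    apply: contra nz => /eqP/(sy _ Qy) e; rewrite eq_mulgV1; apply/eqP/sq1.
      by rewrite groupM ?groupV.
    rewrite expgMn; last exact: (centsP abQ) _ Qy _ (groupVr Qz).
    by rewrite expgVn [y ^+ 2]expgS expg1 {2}e mulKVg mulgV.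
  have cA : (#|A| + 3 = #|Q|)%N.
    rewrite -(cardsID [set 1; z; z ^+ 2] Q) addnC; congr (_ + _)%N.
    rewrite (setIidPr _); last first.
      by apply/subsetP=> w; rewrite !inE => /orP[/orP[]|] /eqP->.
    by rewrite setUC cardsU1 cards2 !inE (negPf nt2) (negPf z2z) eq_sym ntz.
  have [B [sBA sumB]] := involution_halves sK sA.
  exists B; split.
  - apply: subset_trans sBA _; apply/subsetP=> y.
    by rewrite !inE !negb_or -!andbA => /and4P[-> _ -> ->].
  - have := sumB (fun=> 1%R) (fun _ => erefl); rewrite !sumr_const !natz -cA.
    by move: #|A| #|B| => a b; clear; lia.
  have -> : (\sum_(y in B) E y * E (y^-1 * z ^+ 2)%g
             = \sum_(y in B) E y * E (s y))%R.
    by apply: eq_bigr => y /(subsetP sBA)/setDP[Qy _]; rewrite /s Qy.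
  rewrite -(sumB (fun y => E y * E (s y))%R); last first.
    by move=> y; rewrite sK mulrC.
  rewrite -(EC _ Q2 nt2) (bigD1 1) ?group1 //= E1 mul0r add0r.
  rewrite (bigD1 (z ^+ 2)) ?Q2 ?nt2 //= mulVg E1 mulr0 add0r.
  rewrite (bigD1 z) /= ?Qz ?ntz 1?eq_sym ?z2z // {1}expgS mulKg -expr2.
  congr (_ + _)%R; apply: eq_big => [y|y /andP[/andP[/andP[Qy _] _] _]].
    by rewrite !inE !negb_or; case: (y \in Q); case: (y == 1); case: (y == z);
      case: (y == z ^+ 2).
  by rewrite /s Qy.
have ev z : z \in Q -> z != 1 -> (C %% 2)%Z = (E z %% 2)%Z.
  by move=> Qz /(half _ Qz)[B [_ _ ->]]; nia.
have [Ceven | Codd] : (C %% 2 = 0 \/ C %% 2 = 1)%Z by lia.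
  pose E' z := (E z %/ 2)%Z.
  have EE z : z \in Q -> (E z = 2 * E' z)%R.
    have [-> _|ntz Qz] := eqVneq z 1; first by rewrite /E' E1.
    by have := ev _ Qz ntz; rewrite /E'; lia.
  pose C' := (C %/ 4)%Z.
  have sum4 z : z \in Q -> (\sum_(y in Q) E y * E (y^-1 * z)%g
      = 4 * \sum_(y in Q) E' y * E' (y^-1 * z)%g)%R.
    move=> Qz; rewrite mulr_sumr; apply: eq_bigr => y Qy.
    by rewrite !EE ?groupM ?groupV //; ring.
  have CC : C = (4 * C')%R by have := EC _ Qx ntx; rewrite sum4 // /C'; lia.
  have hm : h = (2 * h./2)%N.
    have : (h%:Z ^+ 2 = 4 * (C' * #|Q|%:Z))%R by rewrite -hC CC mulrA.
    move: (C' * _)%R => c; rewrite expr2; nia.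
  apply: (IH h./2 _ C' E'); first by lia.
  - by lia.
  - by rewrite /E' E1.
  - apply: (@mulfI _ 4%R) => //; rewrite mulrA -CC hC {1}hm PoszM exprMn.
    by [].
  by move=> z Qz ntz; have := EC _ Qz ntz; rewrite sum4 // CC => /mulfI ->.
have Eodd z : z \in Q -> z != 1 -> (E z %% 2)%Z = 1%R.
  by move=> Qz ntz; rewrite -ev.
have [B [sB cB CE]] := half _ Qx ntx.
have /(sum_odd_int (B := B)) :
    {in B, forall y, ((E y * E (y^-1 * x ^+ 2)%g)%R %% 2)%Z = 1%R}.
  move=> y /(subsetP sB); rewrite !inE negb_or => /andP[/andP[n1 n2] Qy].
  have := Eodd _ Qy n1; have := Eodd (y^-1 * x ^+ 2).
  rewrite groupM ?groupV ?groupX // -eq_mulVg1 => /(_ isT n2).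
  by move: (E _) (E _) => a b; clear; nia.
move: (\sum_(y in B) _)%R CE (Eodd _ Qx ntx) => S CE Ex S2.
move: hC Codd; rewrite CE -cB; move: #|B| S2 => b S2.
have [m ->] : exists m, E x = (2 * m + 1)%R by exists (E x %/ 2)%Z; lia.
have [t ->] : exists t, S = (2 * t + b%:Z)%R.
  by exists ((S - b%:Z)%R %/ 2)%Z; lia.
have [n [->|->]] : exists n, h = (2 * n)%N \/ h = (2 * n + 1)%N.
- by exists h./2; lia.
  by rewrite PoszD !PoszM !expr2; lia.
by rewrite PoszD PoszM [Posz (2 * n + 1)]PoszD PoszM !expr2; lia.
Qed.

(** * Counting differences *)

Lemma card_diff_in (gT : finGroupType) (D S : {set gT}) :
  #|[set xy in setX D D | xy.1 * xy.2^-1 \in S]|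
    = \sum_(g in S) #|[set xy in setX D D | (xy.1 * xy.2^-1)%g == g]|.
Proof.
rewrite -sum1_card (partition_big (fun xy => xy.1 * xy.2^-1) (mem S)) /=.
  apply: eq_bigr => g Sg; rewrite -sum1_card; apply: eq_bigl => xy.
  by rewrite !inE -andbA; case: eqP => [->|]; rewrite ?Sg ?andbF.
by move=> xy; rewrite inE => /andP[].
Qed.

Lemma card_diff1 (gT : finGroupType) (D : {set gT}) :
  #|[set xy in setX D D | xy.1 * xy.2^-1 == 1]| = #|D|.
Proof.
rewrite -(card_imset (mem D) (f := fun x => (x, x))); last by move=> x y [].
apply: eq_card => -[x y]; rewrite !inE -eq_mulgV1.
apply/andP/imsetP => [[/andP[Dx _] /eqP/= e]|[z Dz [-> ->]]].
  by exists x; rewrite // e.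
by rewrite /= andbb.
Qed.

(** Every second-moment identity below comes from here, with [S] a coset of a
    subgroup or the whole group. *)
Lemma card_diff_difference_set (gT : finGroupType) (v k lambda : nat)
    (G : {group gT}) (D S : {set gT}) :
    difference_set v k lambda G D -> S \subset G ->
  #|[set xy in setX D D | xy.1 * xy.2^-1 \in S]|
    = (lambda * #|S :\ 1%g| + k * (1%g \in S))%N.
Proof.
case=> _ _ _ cD mult /subsetP sSG; rewrite card_diff_in.
rewrite (bigID (fun g => g != 1)) /=; congr (_ + _)%N.
  rewrite mulnC -sum_nat_const; apply: eq_big => [g|g /andP[Sg]].
    by rewrite !inE andbC.
  exact: mult (sSG g Sg).
have [S1|S1] := boolP (1%g \in S); last first.
  rewrite muln0 big1 // => g /andP[Sg /negPn/eqP e].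
  by rewrite -e Sg in S1.
rewrite muln1 (big_pred1 1) ?card_diff1 // => g /=.
by rewrite negbK; case: eqP => [->|]; rewrite ?S1 ?andbF.
Qed.

(** All ordered pairs of points of D, sorted by their difference. *)
Lemma difference_set_eqn (gT : finGroupType) (v k lambda : nat)
    (G : {group gT}) (D : {set gT}) :
  difference_set v k lambda G D -> (k * k = lambda * v.-1 + k)%N.
Proof.
move=> dsD; have [cG sDG _ cD _] := dsD.
have := card_diff_difference_set dsD (subxx G).
have -> : v.-1 = #|G :\ 1%g| by rewrite -cG (cardsD1 1%g G) group1.
rewrite group1 muln1 => <-; rewrite -cD -cardsX.
apply: eq_card => -[x y]; rewrite !inE /=; apply/idP/andP => [|[]//].
by case/andP=> Dx Dy; rewrite Dx Dy groupM ?groupV // (subsetP sDG).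
Qed.

(** * The parameters *)

(** With V = 2 k + h, the second equation reads h^2 - 1 = c (V - 1) for an
    integer c, which is positive.  Since V is 0 modulo h, so is c - 1; as V is
    at least 2 h, having c > 1 would give
    h^2 - 1 >= (1 + h) (2 h - 1).  Hence c = 1. *)
Lemma eq_square_of_skew_eqn (h k l m : nat) :
    1 < h -> 0 < k -> (2 * k + h = m * h)%N ->
    (k * k = l * (2 * k + h).-1 + k)%N ->
  (2 * k + h = h * h)%N.
Proof.
move=> h1 k0 vm ek.
have m2 : 1 < m.
  by rewrite ltnNge; apply/negP => m1; have := leq_mul m1 (leqnn h); lia.
pose V := (2 * k%:Z + h%:Z)%R; pose c := (4 * l%:Z - V + 2 * h%:Z + 1)%R.
have Vm : V = (m%:Z * h%:Z)%R by rewrite /V -PoszM; lia.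
have V1 : (0 < V - 1)%R by rewrite /V; lia.
have Vh : (2 * h%:Z <= V)%R by rewrite Vm; apply: ler_pM => //; lia.
have ekz : (k%:Z * k%:Z = l%:Z * (V - 1) + k%:Z)%R.
  by have -> : (V - 1)%R = Posz (2 * k + h).-1 by [rewrite /V; lia];
    rewrite -!PoszM; lia.
have hc : (h%:Z * h%:Z - 1 = c * (V - 1))%R.
  transitivity (4 * (k%:Z * k%:Z - k%:Z) - (V - 2 * h%:Z - 1) * (V - 1))%R.
    by rewrite /V; ring.
  by rewrite ekz /c; ring.
have c0 : (0 < c)%R.
  rewrite -(pmulr_lgt0 _ V1) -hc -PoszM.
  by have := leq_mul h1 h1; lia.
have cj : c = (1 + h%:Z * (c * m%:Z - h%:Z))%R.
  transitivity (c * V - c * (V - 1))%R; first by ring.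
  by rewrite -hc Vm; ring.
move: (c * m%:Z - h%:Z)%R cj => j cj.
have [j0|j1] : (j <= 0 \/ 1 <= j)%R by lia.
  have hj : (h%:Z * j <= 0)%R by apply: mulr_ge0_le0.
  have c1 : c = 1%R by lia.
  by move: hc; rewrite c1 mul1r -PoszM /V; lia.
have hj : (h%:Z * 1 <= h%:Z * j)%R by apply: ler_pM.
have : ((1 + h%:Z) * (2 * h%:Z - 1) <= c * (V - 1))%R by apply: ler_pM; lia.
have -> : ((1 + h%:Z) * (2 * h%:Z - 1) = 2 * (h * h)%N%:Z + h%:Z - 1)%R.
  by rewrite PoszM; ring.
by rewrite -hc -PoszM; lia.
Qed.

(** Substituting 2 k = h^2 - h turns the counting identity into
    4 l = h^2 - 2 h, and then h is even. *)
Lemma menon_parametrization (h k l : nat) :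
    1 < h -> (2 * k + h = h * h)%N -> (k * k = l * (2 * k + h).-1 + k)%N ->
  exists2 u, 0 < u &
    [/\ h = (2 * u)%N, (k + u = 2 * u ^ 2)%N & (l + u = u ^ 2)%N].
Proof.
move=> h1 kh ek.
have hh1 : (0 < (h * h)%N%:Z - 1)%R by have := leq_mul h1 h1; lia.
have lh : (4 * l + 2 * h = h * h)%N.
  suff : (4 * l%:Z = (h * h)%N%:Z - 2 * h%:Z)%R by lia.
  apply: (@mulIf _ ((h * h)%N%:Z - 1)%R); first by rewrite gt_eqF.
  have ekz : (k%:Z * k%:Z = l%:Z * ((h * h)%N%:Z - 1) + k%:Z)%R.
    have -> : ((h * h)%N%:Z - 1)%R = Posz (2 * k + h).-1 by lia.
    by rewrite -!PoszM; lia.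
  transitivity (4 * (k%:Z * k%:Z - k%:Z))%R; first by rewrite ekz; ring.
  have kz : (2 * k%:Z = h%:Z * h%:Z - h%:Z)%R by rewrite -PoszM -kh; lia.
  transitivity (2 * k%:Z * (2 * k%:Z) - 2 * (2 * k%:Z))%R; first by ring.
  by rewrite kz PoszM; ring.
have [u hu] : exists u, h = (2 * u)%N.
  have [u [hu|hu]] : exists u, h = (2 * u)%N \/ h = (2 * u + 1)%N.
  - by exists h./2; clear; lia.
  - by exists u.
  by move: lh; rewrite hu; clear; lia.
rewrite hu in h1 kh lh *; exists u; first by lia.
by split=> //; rewrite expnS expn1; lia.
Qed.

Lemma card_skew_split (gT : finGroupType) (G D H S : {set gT}) :
    D :&: D^-1 = set0 -> G :\: (D :|: D^-1) = H -> S \subset G ->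
  (#|D :&: S| + #|D :&: S^-1| + #|H :&: S| = #|S|)%N.
Proof.
move=> D0 <- /setIidPr sSG; rewrite -(card_invg (D :&: S^-1)) invIg invgK.
rewrite -(cardsID (D :|: D^-1) S) setIDAC sSG; congr (_ + _)%N.
have DS0 : D :&: S :&: (D^-1 :&: S) = set0 by rewrite setIACA D0 set0I.
by rewrite [S :&: _]setIC setIUl cardsU DS0 cards0 subn0.
Qed.

Lemma menon_parameters (gT : finGroupType) (v k lambda : nat)
    (G : {group gT}) (D : {set gT}) (H : {group gT}) :
    relative_skew_hadamard v k lambda G D H ->
  exists2 u, 0 < u &
    [/\ #|H| = (2 * u)%N, v = (4 * u ^ 2)%N, (k + u = 2 * u ^ 2)%N
      & (lambda + u = u ^ 2)%N].
Proof.
case=> dsD ntH sHG D0 DH; have ek := difference_set_eqn dsD.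
have [cG sDG nD cD _] := dsD.
have vk : v = (2 * k + #|H|)%N.
  have := card_skew_split D0 DH (subxx G).
  by rewrite invGid (setIidPl sDG) (setIidPl sHG) cG cD addnn -mul2n => <-.
have h1 : 1 < #|H| by rewrite cardG_gt1.
have k0 : 0 < k by rewrite -cD card_gt0.
have /dvdnP[m vm] : #|H| %| v by rewrite -cG cardSg.
have kh : (2 * k + #|H| = #|H| * #|H|)%N.
  by apply: (@eq_square_of_skew_eqn _ _ lambda m); rewrite // -vk.
have [|u u0 [hu ku lu]] := @menon_parametrization #|H| k lambda h1 kh.
  by rewrite -vk.
by exists u => //; split=> //; rewrite vk kh hu expnS expn1; lia.
Qed.

(** * Intersection numbers with the cosets of a normal subgroup *)

(** The coefficient at [z] of the image of [D] in the group ring of the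
    quotient. *)
Definition coset_meet (gT : finGroupType) (N : {group gT}) (D : {set gT})
  (z : coset_of N) : nat := #|D :&: z|.

Lemma in_coset (gT : finGroupType) (N G : {group gT}) (nNG : N <| G)
    (x : gT) (z : coset_of N) :
  x \in G -> (x \in (z : {set gT})) = (coset N x == z).
Proof.
move=> Gx; have Nx := subsetP (normal_norm nNG) _ Gx.
by apply/idP/eqP=> [/coset_mem|<-] //; rewrite val_coset ?rcoset_refl.
Qed.

Lemma coset_meetE (gT : finGroupType) (N G : {group gT}) (nNG : N <| G)
    (D : {set gT}) z :
  D \subset G -> coset_meet D z = \sum_(x in D) (coset N x == z).
Proof.
move=> /subsetP sDG; rewrite /coset_meet -sum1_card big_mkcond
  [RHS]big_mkcond /=.
apply: eq_bigr => x _; rewrite inE; case Dx: (x \in D) => //=.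
by rewrite (in_coset nNG) ?sDG //; case: eqP.
Qed.

Lemma sum_coset_meet (gT : finGroupType) (N G : {group gT}) (nNG : N <| G)
    (D : {set gT}) :
  D \subset G ->
  \sum_(z in (G / N)%g) coset_meet D z = #|D|.
Proof.
move=> sDG; under eq_bigr => z _ do rewrite (coset_meetE nNG _ sDG).
rewrite exchange_big /= -sum1_card; apply: eq_bigr => x Dx.
rewrite (bigD1 (coset N x)) ?mem_quotient ?(subsetP sDG) //= eqxx.
rewrite big1 // => z /andP[_].
by rewrite eq_sym => /negPf->.
Qed.

(** The ring homomorphism from Z[G] to Z[G / N] maps D D^-1 to the product of
    the images of D and D^-1. *)
Lemma sum_coset_meet_mul (gT : finGroupType) (N G : {group gT}) (nNG : N <| G)
    (D : {set gT}) z :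
  D \subset G -> z \in (G / N)%g ->
  \sum_(y in (G / N)%g) coset_meet D y * coset_meet D (z^-1 * y)%g
    = #|[set xy in setX D D | (xy.1 * xy.2^-1)%g \in (z : {set gT})]|.
Proof.
move=> sDG Qz; under eq_bigr => y _.
  rewrite 2?(coset_meetE nNG _ sDG) big_distrl /=.
  under eq_bigr => x _ do rewrite big_distrr /=.
over.
rewrite exchange_big /=; under eq_bigr => x Dx do rewrite exchange_big /=.
rewrite pair_big /= -sum1_card [RHS]big_mkcond [LHS]big_mkcond /=.
apply: eq_bigr => -[x y] _; rewrite !inE /=.
have [/andP[Dx Dy]|] := boolP ((x \in D) && (y \in D)) => //=.
have [Gx Gy] : x \in G /\ y \in G by rewrite !(subsetP sDG).
have [Nx Ny] : x \in 'N(N) /\ y \in 'N(N).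
  by rewrite !(subsetP (normal_norm nNG)).
rewrite (in_coset nNG) ?groupM ?groupV // morphM ?morphV ?groupV //=.
rewrite (bigD1 (coset N x)) ?mem_quotient //= eqxx mul1n big1 ?addn0.
  rewrite -(inj_eq (mulgI z)) mulKVg eq_sym.
  rewrite -[in RHS](inj_eq (mulIg (coset N y))) mulgKV.
  by case: eqP.
by move=> w /andP[_]; rewrite eq_sym => /negPf->.
Qed.

Lemma card_coset_of (gT : finGroupType) (N : {group gT}) (z : coset_of N) :
  #|z| = #|N|.
Proof.
by have [x Nx ->] := cosetP z; rewrite val_coset // card_rcoset.
Qed.

Lemma coset_meet_skew (gT : finGroupType) (N G : {group gT}) (nNG : N <| G)
    (D : {set gT}) (H : {group gT}) z :
    D :&: D^-1 = set0 -> G :\: (D :|: D^-1) = H -> z \in (G / N)%g ->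
  (coset_meet D z + coset_meet D z^-1 + coset_meet H z = #|N|)%N.
Proof.
move=> D0 DH Qz; rewrite -(card_coset_of z) -(card_skew_split D0 DH) //.
have /morphimP[x Nx Gx ->] := Qz.
by rewrite val_coset //= mul_subG ?sub1set // normal_sub.
Qed.

Lemma coset_meet1 (gT : finGroupType) (N : {group gT}) (D : {set gT}) :
  coset_meet D (1 : coset_of N)%g = #|D :&: N|.
Proof.
by rewrite /coset_meet -(morph1 (coset N)) /= val_coset ?group1 // mulg1.
Qed.

Lemma Posz_sum (I : finType) (A : {set I}) (F : I -> nat) :
  ((\sum_(i in A) F i)%N%:Z = \sum_(i in A) (F i)%:Z)%R.
Proof. exact: (big_morph Posz PoszD erefl). Qed.

Lemma sum_coset_meet_diff (gT : finGroupType) (v k lambda : nat)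
    (G N : {group gT}) (D : {set gT}) (z : coset_of N) :
    difference_set v k lambda G D -> N <| G -> z \in (G / N)%g ->
  \sum_(y in (G / N)%g) coset_meet D y * coset_meet D (z^-1 * y)%g
    = (lambda * (#|N| - (z == 1%g)) + k * (z == 1%g))%N.
Proof.
move=> dsD nNG Qz; have [_ sDG _ _ _] := dsD.
rewrite (sum_coset_meet_mul nNG sDG Qz) (card_diff_difference_set dsD).
  rewrite -(card_coset_of z) (in_coset nNG) ?group1 // morph1 eq_sym.
  congr (_ * _ + _)%N.
  rewrite [in RHS](cardsD1 1%g) (in_coset nNG) ?group1 // morph1 eq_sym.
  by rewrite addKn.
have /morphimP[x Nx Gx ->] := Qz.
by rewrite val_coset //= mul_subG ?sub1set // normal_sub.
Qed.

(** * Normal subgroups of prime index *)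

(** As G / N has no proper nontrivial subgroup, H maps onto it, so each coset of
    N meets H in a coset of H :&: N. *)
Lemma coset_meet_nsub_prime_index (gT : finGroupType) (G N H : {group gT}) p z :
    N <| G -> prime p -> #|G : N| = p -> H \subset G -> ~~ (H \subset N) ->
    z \in (G / N)%g ->
  (p * coset_meet H z)%N = #|H|.
Proof.
move=> nNG pr_p iN sHG nHN.
have nNH : H \subset 'N(N) := subset_trans sHG (normal_norm nNG).
have cQ : #|G / N| = p by rewrite card_quotient ?normal_norm.
have QH : H / N = G / N.
  apply/eqP; rewrite eqEcard quotientS //= cQ.
  have : #|H / N| %| p by rewrite -cQ cardSg ?quotientS.
  case/primeP: pr_p => _ dv /dv /orP[/eqP/card1_trivg H1|/eqP-> //].
  by rewrite -quotient_sub1 // H1 subxx in nHN.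
have flat y : y \in (G / N)%g -> coset_meet H y = #|H :&: N|.
  rewrite -QH => /morphimP[x Nx Hx ->].
  rewrite /coset_meet /= val_coset // -(card_rcoset (H :&: N) x).
  by apply: eq_card => w; rewrite !(inE, mem_rcoset) [in RHS]groupMr ?groupV.
move=> Qz; rewrite -(sum_coset_meet nNG sHG) (flat z Qz).
by rewrite (eq_bigr _ flat) sum_nat_const cQ.
Qed.

(** The skew relation at the identity coset determines #|D :&: M| in both cases.
    If H is not in M, this value is k / 2, so that D is split evenly by M, and
    the second moment then gives k - lambda = 0. *)
Lemma index2_meet (gT : finGroupType) (v k lambda : nat)
    (G : {group gT}) (D : {set gT}) (H M : {group gT}) :
    relative_skew_hadamard v k lambda G D H -> M \subset G -> #|G : M| = 2 ->
  H \subset M /\ #|D :&: M| = lambda.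
Proof.
move=> sk sMG iM; have nMG := index2_normal sMG iM.
have [u u0 [hu vu ku lu]] := menon_parameters sk.
have [dsD ntH sHG D0 DH] := sk; have [cG sDG _ cD _] := dsD.
have cM : (#|M| = 2 * u ^ 2)%N.
  apply/eqP; rewrite -(eqn_pmul2r (isT : 0 < 2)).
  by rewrite -{1}iM Lagrange // cG vu; lia.
have := coset_meet_skew nMG D0 DH (group1 _).
rewrite invg1 !coset_meet1 cM.
have [sHM|nHM] := boolP (H \subset M).
  by rewrite (setIidPl sHM) hu; split=> //; lia.
have := coset_meet_nsub_prime_index nMG (isT : prime 2) iM sHG nHM (group1 _).
rewrite coset_meet1 hu => hM aM.
have cQ : #|(G / M) :\ 1%g| = 1%N.
  have := cardsD1 1%g (G / M); rewrite group1 card_quotient ?normal_norm // iM.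
  by move=> [].
have /cards1P[z Qz] := introT eqP cQ.
have := sum_coset_meet nMG sDG; rewrite (big_setD1 1%g) ?group1 //= Qz big_set1.
have := sum_coset_meet_diff dsD nMG (group1 _).
rewrite (big_setD1 1%g) ?group1 //= Qz big_set1 invg1 !mul1g eqxx.
rewrite cM cD coset_meet1; have := difference_set_eqn dsD.
move: #|_| (coset_meet _ _) #|H :&: M| aM hM => a b c aM hM ek e2 e1.
have eb : b = a by lia.
exfalso; move: ku lu ek e2; rewrite -e1 eb vu muln1.
have : 0 < u ^ 2 by rewrite expn_gt0 u0.
case: (u ^ 2)%N => // w _ ku lu ek e2.
by have : lambda = (2 * a)%N; lia.
Qed.

(** If H is not in N, then [no_flat_square] is contradicted by 2 d - c, where c
    is the common value of d z + d z^-1.  If H is in N, the sum of the squares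
    (2 p d z - h^2)^2 over z != 1 vanishes. *)
Lemma odd_prime_index_meet (gT : finGroupType) (v k lambda : nat)
    (G : {group gT}) (D : {set gT}) (H N : {group gT}) p :
    relative_skew_hadamard v k lambda G D H -> N <| G -> prime p -> odd p ->
    #|G : N| = p ->
  [/\ H \subset N, (2 * p * #|D :&: N| + p * #|H| = #|H| ^ 2)%N &
    forall z : coset_of N, z \in (G / N)%g -> z != 1%g ->
      (2 * p * coset_meet D z = #|H| ^ 2)%N].
Proof.
move=> sk nNG pr_p odd_p iN.
have [u u0 [hu vu ku lu]] := menon_parameters sk.
have [dsD ntH sHG D0 DH] := sk; have [cG sDG _ cD _] := dsD.
have cN : (p * #|N| = #|H| ^ 2)%N.
  by rewrite mulnC -iN Lagrange ?normal_sub // cG vu hu !expnS !expn0; lia.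
have kh : (2 * k + #|H| = #|H| ^ 2)%N by rewrite hu expnMn; lia.
have lh : (4 * lambda + 2 * #|H| = #|H| ^ 2)%N by rewrite hu expnMn; lia.
have hz : ((#|H| ^ 2)%N%:Z = #|H|%:Z ^+ 2)%R by rewrite -mulnn PoszM expr2.
have nz : (p%:Z * #|N|%:Z = #|H|%:Z ^+ 2)%R by rewrite -hz -cN PoszM.
have kz : (2 * k%:Z = #|H|%:Z ^+ 2 - #|H|%:Z)%R.
  by rewrite -hz -kh PoszD PoszM addrK.
have lz : (4 * lambda%:Z = #|H|%:Z ^+ 2 - 2 * #|H|%:Z)%R.
  by rewrite -hz -lh PoszD !PoszM addrK.
have cQ : #|G / N| = p by rewrite card_quotient ?normal_norm.
have sumD := sum_coset_meet nNG sDG; rewrite cD in sumD.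
have skew z := @coset_meet_skew _ N G nNG D H z D0 DH.
have sub : H \subset N.
  apply/negPn/negP=> nHN.
  have flat z : z \in (G / N)%g -> coset_meet H z = #|H :&: N|.
    move=> Qz; apply/eqP; rewrite -(eqn_pmul2l (prime_gt0 pr_p)) -coset_meet1.
    by rewrite !(coset_meet_nsub_prime_index nNG pr_p iN sHG nHN).
  pose c := (#|N|%:Z - #|H :&: N|%:Z)%R.
  have skewz z : z \in (G / N)%g ->
      ((coset_meet D z^-1)%:Z = c - (coset_meet D z)%:Z)%R.
    by move=> Qz; have := skew z Qz; rewrite (flat z Qz) /c; lia.
  have pc : (p%:Z * c = 2 * k%:Z)%R.
    have := coset_meet_nsub_prime_index nNG pr_p iN sHG nHN (group1 _).
    rewrite coset_meet1 => e.
    have -> : (p%:Z * c = (p * #|N|)%N%:Z - (p * #|H :&: N|)%N%:Z)%R.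
      by rewrite /c !PoszM; ring.
    by rewrite cN e; lia.
  have abQ : abelian (G / N) by apply/cyclic_abelian/prime_cyclic; rewrite cQ.
  have ntQ : G / N != 1.
    by rewrite -cardG_gt1 cQ prime_gt1.
  (* The constant is that of (2 d - c) * (2 d - c) off 1, computed by replacing
     the second factor by its opposite under inversion. *)
  apply: (@no_flat_square _ (G / N)%G abQ _ ntQ #|H|
    (4 * c * k%:Z - 4 * (lambda * #|N|)%N%:Z - p%:Z * c ^+ 2)%R
    (fun z => 2 * (coset_meet D z)%:Z - c)%R).
  - by rewrite /= cQ.
  - exact: cardG_gt0.
  - have := skewz 1%g (group1 _); rewrite invg1 => e.
    by rewrite mulrDl !mul1r [X in (X + _ - _)%R]e subrK subrr.
  - rewrite /= cQ PoszM.
    transitivity (2 * (p%:Z * c) * (2 * k%:Z) - 4 * lambda%:Z * (p%:Z * #|N|%:Z)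
                  - (p%:Z * c) ^+ 2)%R; first by ring.
    by rewrite pc nz kz lz; ring.
  move=> z Qz ntz /=.
  have E2 y : y \in (G / N)%g ->
     (2 * (coset_meet D (y^-1 * z)%g)%:Z - c
        = c - 2 * (coset_meet D (z^-1 * y)%g)%:Z)%R.
    move=> Qy; have := skewz (z^-1 * y)%g.
    by rewrite invMg invgK groupM ?groupV // => -> //; ring.
  have S2 : (\sum_(y in (G / N)%g) (coset_meet D (z^-1 * y)%g)%:Z = k%:Z)%R.
    rewrite -sumD Posz_sum (reindex_inj (mulgI z)) /=.
    by apply: eq_big => [y|y _]; rewrite ?groupMl // mulKg.
  have SS := sum_coset_meet_diff dsD nNG Qz.
  rewrite (negPf ntz) subn0 muln0 addn0 in SS.
  transitivity (\sum_(y in (G / N)%g) (2 * c * (coset_meet D y)%:Z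
     + 2 * c * (coset_meet D (z^-1 * y)%g)%:Z
     - 4 * (coset_meet D y * coset_meet D (z^-1 * y)%g)%N%:Z - c ^+ 2))%R.
    by apply: eq_bigr => y Qy; rewrite E2 // PoszM; ring.
  rewrite !sumrB big_split /= -!mulr_sumr S2 -!Posz_sum SS sumD sumr_const cQ.
  by rewrite -mulr_natl natz; ring.
have skew1 : (2 * #|D :&: N| + #|H| = #|N|)%N.
  by have := skew 1%g (group1 _); rewrite invg1 !coset_meet1 (setIidPl sub)
    addnn mul2n.
split=> // [|z Qz ntz].
  by rewrite -cN -skew1; lia.
have S1 : (#|D :&: N| + \sum_(y in ((G / N) :\ 1)%g) coset_meet D y = k)%N.
  by rewrite -sumD [in RHS](big_setD1 1%g) ?group1 //= coset_meet1.
have S2 : (#|D :&: N| ^ 2 + \sum_(y in ((G / N) :\ 1)%g) coset_meet D y ^ 2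
           = lambda * (#|N| - 1) + k)%N.
  have := sum_coset_meet_diff dsD nNG (group1 _).
  rewrite eqxx muln1 => <-.
  rewrite [in RHS](big_setD1 1%g) ?group1 //= invg1 mul1g.
  rewrite coset_meet1 mulnn; congr (_ + _)%N.
  by apply: eq_bigr => y _; rewrite mul1g mulnn.
have := @psumr_eq0P _ _ (mem ((G / N) :\ 1%g))
  (fun y => (2 * p%:Z * (coset_meet D y)%:Z - #|H|%:Z ^+ 2) ^+ 2)%R.
move=> /(_ (fun y _ => sqr_ge0 _)) var0.
suff /var0/(_ z) : (\sum_(y in ((G / N) :\ 1)%g)
    (2 * p%:Z * (coset_meet D y)%:Z - #|H|%:Z ^+ 2) ^+ 2 = 0)%R.
  rewrite !inE ntz Qz => /(_ isT)/eqP; rewrite sqrf_eq0 subr_eq0 => /eqP.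
  by rewrite -mulnn expr2; lia.
transitivity (\sum_(y in ((G / N) :\ 1)%g) (
    4 * p%:Z ^+ 2 * (coset_meet D y ^ 2)%N%:Z
    - 4 * p%:Z * #|H|%:Z ^+ 2 * (coset_meet D y)%:Z + #|H|%:Z ^+ 4))%R.
  by apply: eq_bigr => y _; rewrite -mulnn PoszM; ring.
rewrite big_split sumrB /= sumr_const -!mulr_sumr -!Posz_sum.
rewrite -[(_ ^+ 4 *+ _)%R]mulr_natl [X in (X * _ ^+ 4)%R]natz.
have -> : (#|((G / N) :\ 1)%g|%:Z = p%:Z - 1)%R.
  have := cardsD1 1%g (G / N); rewrite group1 cQ => ->.
  by rewrite PoszD [RHS]addrC (addKr 1%R).
have dz : (2 * #|D :&: N|%:Z = #|N|%:Z - #|H|%:Z)%R.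
  by rewrite -skew1 PoszD PoszM addrK.
move/(congr1 Posz): S1; rewrite PoszD => /(canRL (addKr _)) ->.
move/(congr1 Posz): S2; rewrite !PoszD => /(canRL (addKr _)) ->.
rewrite -mulnn !PoszM -subzn ?cardG_gt0 //.
transitivity (p%:Z ^+ 2 * (4 * lambda%:Z * (#|N|%:Z - 1) + 2 * (2 * k%:Z)
      - (2 * #|D :&: N|%:Z) ^+ 2)
    - 2 * p%:Z * #|H|%:Z ^+ 2 * (2 * k%:Z - 2 * #|D :&: N|%:Z)
    + (p%:Z - 1) * #|H|%:Z ^+ 4)%R; first by ring.
rewrite kz lz dz.
(* The value factors through p #|N| - h^2, which is 0 because v = h^2. *)
transitivity ((p%:Z * #|N|%:Z - #|H|%:Z ^+ 2)
    * (p%:Z * #|H|%:Z ^+ 2 - p%:Z * #|N|%:Z + #|H|%:Z ^+ 2))%R; first by ring.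
by rewrite nz subrr mul0r.
Qed.

(** * The theorem *)

Theorem theorem1p2 (gT : finGroupType) (v k lambda h : nat)
    (G : {group gT}) (D : {set gT}) (H : {group gT})
    (hG : relative_skew_hadamard v k lambda G D H) (hh : #|H| = h) :
  [/\ (* (a)(i) *)
      forall M : {group gT}, M \subset G -> #|G : M| = 2 ->
        H \subset M /\ #|D :&: M| = lambda,
      (* (a)(ii) *)
      forall (N : {group gT}) (p : nat), N <| G -> prime p -> odd p ->
        #|G : N| = p ->
        [/\ H \subset N,
            forall C : {set gT}, C \in rcosets N G -> C != N ->
              (#|C :&: D|%:R = (1 / (2 * p%:R)) * h%:R ^+ 2 :> rat)%R &
            (#|N :&: D|%:R
               = (1 / (2 * p%:R)) * (h%:R * (h%:R - p%:R)) :> rat)%R] &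
      (* (b) *)
      2.-group G ->
        H \subset 'Phi(G) /\
        forall M : {group gT}, maximal M G -> #|D :&: M| = lambda].
Proof.
have part_i (M : {group gT}) : M \subset G -> #|G : M| = 2 ->
    H \subset M /\ #|D :&: M| = lambda.
  exact: index2_meet hG.
split=> // [N p nNG pr_p odd_p iN|G2].
  have [sHN dN dz] := odd_prime_index_meet hG nNG pr_p odd_p iN.
  have p2 : (2 * p%:R != 0 :> rat)%R.
    by rewrite mulf_neq0 ?pnatr_eq0 // -lt0n prime_gt0.
  rewrite hh in dN dz; split=> // [C /rcosetsP[x Gx ->] ntC|].
    have Nx := subsetP (normal_norm nNG) _ Gx.
    have ntx : coset N x != 1.
      by apply: contra ntC => /eqP/(coset_idr Nx)/rcoset_id/eqP.
    have := dz _ (mem_quotient N Gx) ntx.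
    rewrite /coset_meet /= val_coset // setIC => e.
    apply: (mulfI p2); rewrite mul1r mulVKf //.
    by rewrite -natrX -!natrM e.
  apply: (mulfI p2); rewrite mul1r mulVKf // setIC mulrBr -!natrM.
  by apply/eqP; rewrite eq_sym subr_eq -natrD mulnn -dN (mulnC h).
have maxM (M : {group gT}) : maximal M G -> H \subset M /\ #|D :&: M| = lambda.
  move=> maxM; apply: part_i (p_maximal_index G2 maxM).
  exact: proper_sub (maxgroupp maxM).
split=> [|M /maxM[] //].
by apply/bigcapsP => M /predU1P[->|/maxM[]] //; have [_ _] := hG.
Qed.
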